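(* Let $S,T\in\mathbb{C}[[z]]$ be such that $\langle\nabla(D_iS),\nabla(D_jT)\rangle=0$ for all $1\le i,j\le n$. Let $P=S+T$. Then: (a) $\mathrm{Hes}(S)\,\mathrm{Hes}(T)=\mathrm{Hes}(T)\,\mathrm{Hes}(S)=0$. (b) $P$ is HN if and only if both $S$ and $T$ are HN.
   Context: $z=(z_1,\dots,z_n)$ are commuting variables, $D_i=\partial/\partial z_i$, and $\nabla g=(D_1g,\dots,D_ng)$. $\langle\cdot,\cdot\rangle$ denotes the standard $\mathbb{C}$-bilinear form, $\langle u,v\rangle=\sum_k u_kv_k$ (applied to vectors of power series as well). $\mathrm{Hes}(g)=(D_iD_jg)_{n\times n}$ is the Hessian matrix. A polynomial or formal power series $g\in\mathbb{C}[[z]]$ is HN (Hessian nilpotent) if $\mathrm{Hes}(g)$ is a nilpotent matrix. *)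

(* Defs.v *)
From HB Require Import structures.
From mathcomp Require Import all_boot all_order all_algebra.
From mathcomp Require Import mpoly complex.
From mathcomp Require Import boolp reals.

Set Implicit Arguments.
Unset Strict Implicit.
Unset Printing Implicit Defensive.

Import GRing.Theory.
Local Open Scope ring_scope.

(* R[[z_1, ..., z_n]]: a formal power series is its family of coefficients,
   indexed by the exponents of monomials.  The record keeps the Cauchy product
   below apart from the pointwise product that functions already carry. *)
Record fps (R : Type) (n : nat) := Fps { fcoef : 'X_{1..n} -> R }.

Notation "{ 'fps' R [ n ] }" := (fps R n)
  (at level 0, R, n at level 2, format "{ 'fps'  R [ n ] }") : type_scope.

HB.instance Definition _ (R : Type) (n : nat) := gen_eqMixin {fps R[n]}.
HB.instance Definition _ (R : Type) (n : nat) := gen_choiceMixin {fps R[n]}.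

Section FpsRing.
Context {R : comNzRingType} {n : nat}.
Implicit Types (f g h : {fps R[n]}) (m : 'X_{1..n}).

Lemma fpsP f g : (forall m, fcoef f m = fcoef g m) -> f = g.
Proof. by case: f g => [f] [g] /= /funext ->. Qed.

Definition fps_zero : {fps R[n]} := Fps (fun=> 0).
Definition fps_one : {fps R[n]} := Fps (fun m => (m == 0%MM)%:R).
Definition fps_opp f : {fps R[n]} := Fps (fun m => - fcoef f m).
Definition fps_add f g : {fps R[n]} := Fps (fun m => fcoef f m + fcoef g m).

(* k ranges over all pairs of exponents with sum m; the degree bounds only
   make this range a finite type, as in mcoeffM. *)
Definition fps_mul f g : {fps R[n]} := Fps (fun m =>
  \sum_(k : 'X_{1..n < (mdeg m).+1, (mdeg m).+1} | m == (k.1 + k.2)%MM)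
     fcoef f k.1 * fcoef g k.2).

Fact fps_addA : associative fps_add.
Proof. by move=> f g h; apply: fpsP => m /=; rewrite addrA. Qed.
Fact fps_addC : commutative fps_add.
Proof. by move=> f g; apply: fpsP => m /=; rewrite addrC. Qed.
Fact fps_add0 : left_id fps_zero fps_add.
Proof. by move=> f; apply: fpsP => m /=; rewrite add0r. Qed.
Fact fps_addN : left_inverse fps_zero fps_opp fps_add.
Proof. by move=> f; apply: fpsP => m /=; rewrite addNr. Qed.

HB.instance Definition _ := GRing.isZmodule.Build {fps R[n]}
  fps_addA fps_addC fps_add0 fps_addN.

(* The ring laws are inherited from {mpoly R[n]} by truncation. *)
Let trunc d f : {mpoly R[n]} :=
  \sum_(m : 'X_{1..n < d}) fcoef f m *: 'X_[m].

Let coef_trunc d f m : (mdeg m < d)%N -> (trunc d f)@_m = fcoef f m.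
Proof. exact: mcoeff_mpoly. Qed.

Let mdeg_split d (k : 'X_{1..n} * 'X_{1..n}) m :
  m = (k.1 + k.2)%MM -> (mdeg m < d)%N -> (mdeg k.1 < d)%N /\ (mdeg k.2 < d)%N.
Proof.
by move=> ->; rewrite mdegD => md; split; apply: leq_ltn_trans md;
   rewrite ?leq_addl ?leq_addr.
Qed.

Let eq_coefM (p q p' q' : {mpoly R[n]}) d :
  (forall m, (mdeg m < d)%N -> p@_m = p'@_m) ->
  (forall m, (mdeg m < d)%N -> q@_m = q'@_m) ->
  forall m, (mdeg m < d)%N -> (p * q)@_m = (p' * q')@_m.
Proof.
move=> pp' qq' m md; rewrite !mcoeffM; apply: eq_bigr => k /eqP mE.
have [k1d k2d] := @mdeg_split d (val k.1, val k.2) m mE md.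
by rewrite pp' ?qq'.
Qed.

Let coef_mul d f g m : (mdeg m < d)%N ->
  fcoef (fps_mul f g) m = (trunc d f * trunc d g)@_m.
Proof.
move=> md; rewrite mcoeffM /=; apply: eq_bigr => k /eqP mE.
have [k1d k2d] := @mdeg_split d (val k.1, val k.2) m mE md.
by rewrite !coef_trunc.
Qed.

Let truncM d f g m : (mdeg m < d)%N ->
  (trunc d (fps_mul f g))@_m = (trunc d f * trunc d g)@_m.
Proof. by move=> md; rewrite coef_trunc // (coef_mul _ _ md). Qed.

Fact fps_mulA : associative fps_mul.
Proof.
move=> f g h; apply: fpsP => m; rewrite !(coef_mul _ _ (ltnSn _)).
rewrite (@eq_coefM _ _ (trunc (mdeg m).+1 f)
  (trunc (mdeg m).+1 g * trunc (mdeg m).+1 h) (mdeg m).+1) //; last first.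
  by move=> k; apply: truncM.
by rewrite mulrA; apply: (@eq_coefM _ _ _ _ (mdeg m).+1) => // k kd; rewrite truncM.
Qed.

Fact fps_mulC : commutative fps_mul.
Proof.
by move=> f g; apply: fpsP => m; rewrite !(coef_mul _ _ (ltnSn _)) mulrC.
Qed.

Fact fps_mul1 : left_id fps_one fps_mul.
Proof.
move=> f; apply: fpsP => m; rewrite (coef_mul _ _ (ltnSn _)).
rewrite -[RHS](coef_trunc f (ltnSn _)) -[in RHS](mul1r (trunc _ f)).
apply: (@eq_coefM _ _ _ _ (mdeg m).+1) => // k kd.
by rewrite coef_trunc // mcoeff1.
Qed.

Fact fps_mulDl : left_distributive fps_mul +%R.
Proof.
move=> f g h; apply: fpsP => m /=; rewrite -big_split /=.
by apply: eq_bigr => k _; rewrite mulrDl.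
Qed.

Fact fps_oner_neq0 : fps_one != 0.
Proof.
apply/eqP => /(congr1 (fun f => fcoef f 0%MM)) /=.
by rewrite eqxx => /eqP; rewrite oner_eq0.
Qed.

HB.instance Definition _ := GRing.Zmodule_isComNzRing.Build {fps R[n]}
  fps_mulA fps_mulC fps_mul1 fps_mulDl fps_oner_neq0.

End FpsRing.

Section Hessian.
Context {R : comNzRingType} {n : nat}.
Implicit Types g : {fps R[n]}.

(* D_i z^(m + e_i) = (m_i + 1) z^m, so only the exponent m + e_i of g
   contributes to the exponent m of D_i g. *)
Definition fderiv (i : 'I_n) g : {fps R[n]} :=
  Fps (fun m => fcoef g (m + U_(i))%MM *+ (m i).+1).

Definition gradient g : 'rV[{fps R[n]}]_n := \row_k fderiv k g.

Definition bilin (u v : 'rV[{fps R[n]}]_n) : {fps R[n]} :=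
  \sum_k u 0 k * v 0 k.

Definition hessian g : 'M[{fps R[n]}]_n :=
  \matrix_(i, j) fderiv i (fderiv j g).

Definition nilpotent_mx (A : 'M[{fps R[n]}]_n) : Prop :=
  exists k : nat, A ^+ k = 0.

Definition hessian_nilpotent g : Prop := nilpotent_mx (hessian g).

End Hessian.

(* Main.v *)
Require Import Defs.
From mathcomp Require Import all_boot all_order all_algebra.
From mathcomp Require Import mpoly complex.
From mathcomp Require Import reals.

Import GRing.Theory.

Local Open Scope ring_scope.

(** Partial derivatives commute, so the entries of Hes(S) Hes(T) are exactly the forms assumed to
    vanish ([hessian_mul0]); symmetry of the form gives the product in the other order. As Hes is
    additive, the equivalence becomes a fact about ring elements with ab = ba = 0
    ([nilpotentD_mul0]): the mixed terms of (a + b)^k drop out, leaving a^k + b^k for k > 0. *)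

Lemma fderivC (R : comNzRingType) (n : nat) (i j : 'I_n) (g : {fps R[n]}) :
  fderiv i (fderiv j g) = fderiv j (fderiv i g).
Proof.
have [-> //|nij] := eqVneq i j.
apply: fpsP => m /=.
(* As i and j differ, a shift by one unit exponent leaves the other index alone: both sides carry
   the factor (m_i + 1)(m_j + 1). *)
rewrite !mnmDE !mnmE (eq_sym j) (negPf nij) !addn0.
by rewrite -!mulrnA mulnC -!addmA (addmC U_(i)%MM).
Qed.

Lemma hessian_mul0 (R : comNzRingType) (n : nat) (S T : {fps R[n]}) :
  (forall i j : 'I_n,
     bilin (gradient (fderiv i S)) (gradient (fderiv j T)) = 0) ->
  hessian S *m hessian T = 0.
Proof.
move=> hST; apply/matrixP => i j; rewrite !mxE -[RHS](hST i j).
(* Only the factor from S needs its derivatives swapped. *)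
by apply: eq_bigr => k _; rewrite !mxE (fderivC _ _ i).
Qed.

Lemma bilinC (R : comNzRingType) (n : nat) (u v : 'rV[{fps R[n]}]_n) :
  bilin u v = bilin v u.
Proof. by apply: eq_bigr => k _; rewrite mulrC. Qed.

Lemma hessianD (R : comNzRingType) (n : nat) (S T : {fps R[n]}) :
  hessian (S + T) = hessian S + hessian T.
Proof.
by apply/matrixP => i j; rewrite !mxE; apply: fpsP => m /=; rewrite !mulrnDl.
Qed.

(** The exponent is a successor because exponent 0 would give 1 = 1 + 1. A [pzRingType] may be
    trivial, which covers matrices of size n = 0. *)
Lemma exprD_mul0 (A : pzRingType) (a b : A) (k : nat) :
  a * b = 0 -> b * a = 0 -> (a + b) ^+ k.+1 = a ^+ k.+1 + b ^+ k.+1.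
Proof.
move=> ab ba; elim: k => [|k IHk]; first by rewrite !expr1.
have akb : a ^+ k.+1 * b = 0 by rewrite exprSr -mulrA ab mulr0.
have bka : b ^+ k.+1 * a = 0 by rewrite exprSr -mulrA ba mulr0.
by rewrite exprSr IHk mulrDl !mulrDr akb bka addr0 add0r -!exprSr.
Qed.

(* From a^(k+1) + b^(k+1) = 0, multiplying by a kills the second term. *)
Lemma nilpotent_summand (A : pzRingType) (a b : A) (k : nat) :
  a * b = 0 -> b * a = 0 -> (a + b) ^+ k = 0 -> a ^+ k.+2 = 0.
Proof.
move=> ab ba abk.
have bka : b ^+ k.+1 * a = 0 by rewrite exprSr -mulrA ba mulr0.
have: (a + b) ^+ k.+1 * a = 0 by rewrite exprSr abk !mul0r.
by rewrite exprD_mul0 // mulrDl bka addr0 -exprSr.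
Qed.

Lemma nilpotentD_mul0 (A : pzRingType) (a b : A) :
  a * b = 0 -> b * a = 0 ->
  (exists k, (a + b) ^+ k = 0) <->
  (exists k, a ^+ k = 0) /\ (exists k, b ^+ k = 0).
Proof.
move=> ab ba; split=> [[k abk]|[[k ak] [l bl]]].
  split; exists k.+2; first exact: nilpotent_summand ab ba abk.
  by apply: nilpotent_summand ba ab _; rewrite addrC.
(* This exponent is at least k and l, so both powers vanish, and it is positive, so the power of the
   sum splits. *)
exists (k + l).+1; rewrite exprD_mul0 // !exprS !exprD ak bl.
by rewrite mul0r !mulr0 addr0.
Qed.

Theorem theorem2p1 (R : realType) (n : nat) (S T P : {fps R[i][n]})
  (hST : forall i j : 'I_n,
     bilin (gradient (fderiv i S)) (gradient (fderiv j T)) = 0)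
  (hP : P = S + T) :
  (hessian S *m hessian T = 0 /\ hessian T *m hessian S = 0) /\
  (hessian_nilpotent P <-> hessian_nilpotent S /\ hessian_nilpotent T).
Proof.
have ST0 := @hessian_mul0 _ _ _ _ hST.
have TS0 : hessian T *m hessian S = 0.
  by apply: hessian_mul0 => i j; rewrite bilinC; exact: hST.
split; first exact: conj ST0 TS0.
rewrite hP /hessian_nilpotent hessianD.
exact: nilpotentD_mul0 ST0 TS0.
Qed.
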